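(* Let $M=(V,H)$ be a multilog of size $|V|=n$, and assume that all concurrent operations of $M$ commute. Let $T=\langle \mathrm{init};\alpha_1;\ldots;\alpha_{n-1}\rangle$ be a complete state of $M$, i.e. $T\in\mathrm{state}(M)$ and $\{\mathrm{init},\alpha_1,\ldots,\alpha_{n-1}\}=V$. Let $\rho$ be an arbitrary permutation of $\{1,2,\ldots,n-1\}$, and let $T_\rho$ denote the sequence $\langle \mathrm{init};\alpha_{\rho(1)};\ldots;\alpha_{\rho(n-1)}\rangle$. Then, if $T_\rho$ is a state, it is equivalent to $T$: $T_\rho\in\mathrm{state}(M)\implies T\equiv T_\rho$.
   Context: A multilog $M=(V,H)$ is a directed graph consisting of a set $V$ of operations connected by the happens-before relation $H=\{(x,y)\in V\times V : x\to y\}$, where $x\to y$ means ''$x$ happens before $y$'' (Lamport's happens-before, a strict partial order). Two operations $x,y$ are concurrent, written $x\parallel y$, if neither $x\to y$ nor $y\to x$. There is a distinguished operation $\mathrm{init}$ (denoting the common initial state). A schedule of $M$ is a sequential enumeration, without repetition, of operations of $V$ in some order consistent with happens-before: formally $T=(L,<_T)$ with $L\subseteq V$ and $<_T$ the strict total order of the enumeration, such that for all $x,y\in L$, $x\to y$ implies $x<_T y$. The set of schedules of $M$ is $\mathrm{sched}(M)$. A schedule is complete if it contains all operations, i.e. $L=V$. For a sequence $T$ and an operation $v$, $\langle T;v\rangle$ denotes $T$ followed by $v$. A quasi-state is a schedule of $M$ whose initial element is $\mathrm{init}$. Quasi-states are divided, in some application-specific manner, into legal and illegal ones, and any extension of an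 illegal quasi-state is itself illegal. A legal quasi-state is called a state; the set of states is $\mathrm{state}(M)$. An equivalence relation $\equiv$ between states is assumed to exist; like legality, it is application dependent. ''All concurrent operations commute'' means: for every $T\in\mathrm{state}(M)$ and all distinct $x,y\in V$ such that $x\parallel y$, $\langle T;x\rangle\in\mathrm{state}(M)$ and $\langle T;y\rangle\in\mathrm{state}(M)$, the sequences $\langle T;x;y\rangle$ and $\langle T;y;x\rangle$ are both in $\mathrm{state}(M)$ and $\langle T;x;y\rangle\equiv\langle T;y;x\rangle$.
   Formalization: Added assumption: if two states with the same operations are equivalent and appending an operation v to one gives a state, then appending v to the other gives an equivalent state. For an arbitrary equivalence relation on states the claim is false. *)

(* Defs.v *)
From mathcomp Require Import all_boot all_fingroup.

Set Implicit Arguments.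
Unset Strict Implicit.
Unset Printing Implicit Defensive.

Record multilog := Multilog {
  op :> finType;
  hb : rel op;
  hb_irr : irreflexive hb;
  hb_trans : transitive hb;
  init : op
}.

Definition concurrent (M : multilog) (x y : M) : bool :=
  ~~ hb x y && ~~ hb y x.

(* A sequence T stands for the pair (L, <_T): L is its set of elements and
   x <_T y is the comparison of positions in T. *)
Definition schedule (M : multilog) (T : seq M) : Prop :=
  uniq T /\ {in T &, forall x y, hb x y -> index x T < index y T}.

Definition complete (M : multilog) (T : seq M) : Prop :=
  [set x in T] = [set: M].

Definition quasi_state (M : multilog) (T : seq M) : Prop :=
  schedule T /\ exists s, T = init M :: s.

(* Legality and equivalence are typed on all sequences, but every law (and
   every use below) is restricted to quasi-states, respectively states; the
   values elsewhere are irrelevant. *)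
Record semantics (M : multilog) := Semantics {
  legal : seq M -> Prop;
  illegal_ext : forall T U : seq M,
    quasi_state T -> quasi_state (T ++ U) -> ~ legal T -> ~ legal (T ++ U);
  state_equiv : seq M -> seq M -> Prop;
  state_equiv_refl : forall T,
    quasi_state T -> legal T -> state_equiv T T;
  state_equiv_sym : forall T1 T2,
    quasi_state T1 -> legal T1 -> quasi_state T2 -> legal T2 ->
    state_equiv T1 T2 -> state_equiv T2 T1;
  state_equiv_trans : forall T1 T2 T3,
    quasi_state T1 -> legal T1 -> quasi_state T2 -> legal T2 ->
    quasi_state T3 -> legal T3 ->
    state_equiv T1 T2 -> state_equiv T2 T3 -> state_equiv T1 T3
}.

Definition state (M : multilog) (A : semantics M) (T : seq M) : Prop :=
  quasi_state T /\ legal A T.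

(* [rcons T x] is the sequence <T; x>. *)
Definition concurrent_ops_commute (M : multilog) (A : semantics M) : Prop :=
  forall (T : seq M) (x y : M),
    state A T -> x != y -> concurrent x y ->
    state A (rcons T x) -> state A (rcons T y) ->
    [/\ state A (rcons (rcons T x) y),
        state A (rcons (rcons T y) x) &
        state_equiv A (rcons (rcons T x) y) (rcons (rcons T y) x)].

(* Equivalent states made of the same operations admit the same next
   operations, with equivalent results. This law is assumed in addition to
   [state_equiv] being an equivalence relation, and does not follow from it:
   commutation only relates sequences that differ in their last two
   operations, so without some such law swapping two earlier operations need
   not preserve legality or equivalence, and distinct complete states need not
   be equivalent even when all concurrent operations commute. *)
Definition state_equiv_extends (M : multilog) (A : semantics M) : Prop :=
  forall (T1 T2 : seq M) (v : M),
    state A T1 -> state A T2 -> perm_eq T1 T2 -> state_equiv A T1 T2 ->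
    state A (rcons T1 v) ->
    state A (rcons T2 v) /\ state_equiv A (rcons T1 v) (rcons T2 v).

(* <init; a_1; ...; a_k>, with a_1, ..., a_k indexed from 0 by 'I_k. *)
Definition run (M : multilog) (k : nat) (a : 'I_k -> M) : seq M :=
  init M :: [seq a i | i <- enum 'I_k].

(* Main.v *)
(** Two states over the same operations are brought together from the front.
    Let them read [U; x1; ..; xk; y; R] and [U; y; ..]. Each [xi] is concurrent
    with [y], being scheduled before it in the first and after it in the second.
    As [U; y] and [U; x1] are both prefixes of states, commutation applies to
    them, then to [U; x1; y] and [U; x1; x2], and so on, so that [y] moves in
    front of [x1; ..; xk]; this lengthens the common prefix of the two states. *)
Require Import Defs.
From mathcomp Require Import all_boot all_fingroup.
From Stdlib Require Import Classical.

Set Implicit Arguments.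
Unset Strict Implicit.
Unset Printing Implicit Defensive.

Lemma schedule_not_hb (M : multilog) (P Q : seq M) (a b : M) :
  schedule (P ++ a :: Q) -> b \in Q -> ~~ hb b a.
Proof.
move=> [uT ordT] bQ; apply/negP => hba.
have := ordT b a; rewrite !mem_cat !inE eqxx bQ !orbT => /(_ isT isT hba).
move: uT; rewrite cat_uniq /= => /and3P[_ /norP[aP /hasPn nP] /andP[aQ _]].
(* With [b] outside [P], both indices are offset by [size P], and [a] sits at offset 0, below which
   nothing lies. *)
have bP := nP _ bQ.
by rewrite !index_cat (negbTE aP) (negbTE bP) ltn_add2l /= eqxx.
Qed.

Lemma schedule_catl (M : multilog) (P Q : seq M) :
  schedule (P ++ Q) -> schedule P.
Proof.
move=> [uT ordT]; split; first by move: uT; rewrite cat_uniq => /andP[].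
move=> x y xP yP hxy; have := ordT x y.
by rewrite !mem_cat !index_cat xP yP => /(_ isT isT hxy).
Qed.

Section States.

Variables (M : multilog) (A : semantics M).
Implicit Types (P Q R U T s t : seq M) (x y : M).

Lemma state_neq0 T : state A T -> T != [::].
Proof. by case=> [[_ [s ->]] _]. Qed.

(** A quasi-state starts with [init], so only nonempty prefixes qualify. Legality descends by
    contraposing [illegal_ext]; being an arbitrary [Prop], it is recovered through excluded
    middle. *)
Lemma state_catl P Q : P != [::] -> state A (P ++ Q) -> state A P.
Proof.
case: P => // p P _ [qT lT].
have qP : quasi_state (p :: P).
  case: qT => sT [s [pE _]]; split; last by exists P; rewrite pE.
  exact: (@schedule_catl _ (p :: P) Q).
split=> //; apply: NNPP => nl.
exact: (illegal_ext qP qT nl) lT.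
Qed.

Lemma equiv_refl T : state A T -> state_equiv A T T.
Proof. by case; apply: state_equiv_refl. Qed.

Lemma equiv_trans T2 T1 T3 : state A T1 -> state A T2 -> state A T3 ->
  state_equiv A T1 T2 -> state_equiv A T2 T3 -> state_equiv A T1 T3.
Proof. by move=> [? ?] [? ?] [? ?]; apply: state_equiv_trans. Qed.

Hypothesis commute : concurrent_ops_commute A.
Hypothesis extends : state_equiv_extends A.

(** Carries an equivalence obtained by a swap across the operations that follow it. [extends]
    applies at each one, since appending the same operation keeps the two sides permutations of each
    other. *)
Lemma equiv_cat T1 T2 R :
  state A T1 -> state A T2 -> perm_eq T1 T2 -> state_equiv A T1 T2 ->
  state A (T1 ++ R) ->
  state A (T2 ++ R) /\ state_equiv A (T1 ++ R) (T2 ++ R).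
Proof.
move=> sT1 sT2 T12 e12; elim/last_ind: R => [|R v IH]; first by rewrite !cats0.
rewrite -!rcons_cat => sR.
have sR1 : state A (T1 ++ R).
  apply: (@state_catl _ [:: v]); last by rewrite cats1.
  by case: (T1) (state_neq0 sT1).
have [sR2 eR] := IH sR1.
by apply: extends => //; rewrite perm_cat2r.
Qed.

(** Induction from the right end of [s]. The first conjunct feeds the induction: commutation with
    the next operation requires [y] to be still possible after [s]. *)
Lemma commute_past U s y :
  U != [::] -> state A (U ++ s) -> state A (rcons U y) ->
  {in s, forall x, x != y /\ concurrent x y} ->
  [/\ state A (rcons (U ++ s) y), state A (rcons U y ++ s) &
      state_equiv A (rcons (U ++ s) y) (rcons U y ++ s)].
Proof.
move=> U0; elim/last_ind: s => [|s x IH].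
  by rewrite !cats0 => _ sy _; split=> //; apply: equiv_refl.
rewrite -!rcons_cat => sx sy conc.
have ss : state A (U ++ s).
  apply: (@state_catl _ [:: x]); last by rewrite cats1.
  by case: (U) U0.
have [z zs|ssy sys eys] := IH ss sy.
  by apply: conc; rewrite mem_rcons inE zs orbT.
have [|xy cxy] := conc x; first by rewrite mem_rcons mem_head.
have [sxy syx exy] := commute ss xy cxy sx ssy.
have perm_ys : perm_eq (rcons (U ++ s) y) (rcons U y ++ s).
  by rewrite -!cats1 -!catA perm_cat2l perm_catC.
(* Extended by [x], the induction hypothesis relates [<U; s; y; x>] to [<U; y; s; x>]; transitivity
   joins this to the swap [exy]. *)
have [sysx eyx] := extends ssy sys perm_ys eys syx.
by split=> //; apply: equiv_trans eyx.
Qed.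

(** The prefix [U] is left general so that induction on [t] can absorb its head [y] into it. *)
Lemma perm_equiv U s t :
  U != [::] -> state A (U ++ s) -> state A (U ++ t) -> perm_eq s t ->
  state_equiv A (U ++ s) (U ++ t).
Proof.
elim: t U s => [|y t IH] U s U0 sS sT st.
  by move/perm_nilP: st sS => -> sS; apply: equiv_refl.
have yP : rcons U y != [::] by case: (U).
have sy : state A (rcons U y) by apply: (@state_catl _ t); rewrite ?cat_rcons.
have ys : y \in s by rewrite (perm_mem st) mem_head.
case/splitPr: ys sS st => s1 s2 sS st.
have us : uniq (s1 ++ y :: s2).
  by case: sS => [[[uS _] _] _]; move: uS; rewrite (cat_uniq U) => /and3P[].
have conc : {in s1, forall x, x != y /\ concurrent x y}.
  move=> x xs1.
  have xy : x != y.
    apply: contraTneq us => <-; rewrite cat_uniq /= xs1 /=.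
    by rewrite andbF.
  split=> //; apply/andP; split.
    case: sT => [[schT _] _]; apply: schedule_not_hb schT _.
    have: x \in y :: t by rewrite -(perm_mem st) mem_cat xs1.
    by rewrite inE (negbTE xy).
  case: sS => [[schS _] _]; case/splitPr: xs1 schS => p1 p2.
  rewrite -catA /= catA => schS; apply: schedule_not_hb schS _.
  by rewrite mem_cat mem_head orbT.
have ss1 : state A (U ++ s1).
  apply: (@state_catl _ (y :: s2)); last by rewrite -catA.
  by case: (U) U0.
have [s1y sys1 ey] := commute_past U0 ss1 sy conc.
have perm1 : perm_eq (rcons (U ++ s1) y) (rcons U y ++ s1).
  by rewrite -!cats1 -!catA perm_cat2l perm_catC.
have sS' : state A (rcons (U ++ s1) y ++ s2) by rewrite cat_rcons -catA.
have [sU eU] := equiv_cat s1y sys1 perm1 ey sS'.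
(* The chain goes from [<U; s1; y; s2>] to [<U; y; s1; s2>] by [eU], then to [<U; y; t>] by
   induction with prefix [rcons U y]. *)
rewrite catA -(cat_rcons y (U ++ s1)); apply: (equiv_trans _ sU) => //.
rewrite -catA -(cat_rcons y U t); apply: IH => //; rewrite ?cat_rcons //.
  by rewrite -cat_rcons catA.
by rewrite -(perm_cons y) -(permPr st) -cat_cons -cat1s -catA perm_catCA.
Qed.

End States.

Lemma perm_run (M : multilog) (k : nat) (a : 'I_k -> M) (rho : 'S_k) :
  perm_eq [seq a i | i <- enum 'I_k] [seq a (rho i) | i <- enum 'I_k].
Proof.
rewrite (map_comp a rho); apply: perm_map; apply: uniq_perm.
- exact: enum_uniq.
- by rewrite (map_inj_uniq (@perm_inj _ rho)) enum_uniq.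
move=> i; rewrite mem_enum; apply/esym/mapP; exists (rho^-1 i)%g.
  by rewrite mem_enum.
by rewrite permKV.
Qed.

Theorem theorem2 (M : multilog) (A : semantics M) (n : nat)
    (card_V : #|M| = n)
    (commute : concurrent_ops_commute A)
    (extends : state_equiv_extends A)
    (alpha : 'I_n.-1 -> M)
    (T_state : state A (run alpha))
    (T_complete : complete (run alpha))
    (rho : 'S_n.-1) :
  state A (run (fun i => alpha (rho i))) ->
  state_equiv A (run alpha) (run (fun i => alpha (rho i))).
Proof.
move=> Trho_state.
(* The shared [init] serves as the nonempty starting prefix. *)
exact: (@perm_equiv _ _ commute extends [:: init M]) (perm_run alpha rho).
Qed.
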